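(* For all integers $k \ge 0$ and $n \ge 0$, $$(-1)^{k\binom{n}{2}} D_k(n) = \prod_{j=1}^{k}\left(\frac{j+n}{j}\right)^{\min(j,k-j)} = \prod_{i=1}^{\lfloor k/2 \rfloor}\prod_{j=1}^{\lceil k/2 \rceil} \frac{i+j+n-1}{i+j-1}.$$
   Context: For $m\ge 0$ let $b(m)=\binom{m}{\lfloor m/2\rfloor}$ (the middle binomial coefficients), and let $D_k(n)=\det\left(b(k+i+j)\right)_{i,j=0}^{n-1}$ be their Hankel determinants, with $D_k(0)=1$ (empty determinant). Empty products equal $1$. *)

(* Defs.v *)
From mathcomp Require Import all_boot all_order all_algebra.

Set Implicit Arguments.
Unset Strict Implicit.
Unset Printing Implicit Defensive.

Import GRing.Theory.
Local Open Scope ring_scope.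

Definition midbin (m : nat) : nat := 'C(m, m./2).

(* For n = 0 this is the determinant of the empty matrix, which is 1. *)
Definition hankel_det (k n : nat) : int :=
  \det (\matrix_(i < n, j < n) (midbin (k + i + j)%N)%:Z).

(* Main.v *)
Require Import Defs.
From mathcomp Require Import all_boot all_order all_algebra.
From mathcomp Require Import perm ring zify.

Set Implicit Arguments.
Unset Strict Implicit.
Unset Printing Implicit Defensive.

Import GRing.Theory Num.Theory.
Local Open Scope ring_scope.

(** The Hankel matrix of size n + 2 for the shift k contains five smaller
    Hankel matrices: its interior is the one of size n for the shift k + 2, and
    its four corner blocks of size n + 1 are those for the shifts k, k + 1
    (twice) and k + 2. The Desnanot-Jacobi identity therefore reads

      D_k(n+2) D_{k+2}(n) = D_k(n+1) D_{k+2}(n+1) - D_{k+1}(n+1)^2,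

    and as long as D_{k+2}(n) <> 0 it determines all the D_k(n) from their
    values 1 at n = 0 and b(k) at n = 1. It remains to see that the right-hand
    side of the theorem, with its sign, has the same initial values and obeys
    the same recurrence ([box_n0], [box_n1], [box_condensation]).

    The double product is MacMahon's count of the plane partitions in a box with
    sides floor(k/2), ceil(k/2) and n. Increasing k by one adds one
    line to the rectangle of pairs (i, j), and in both parities of k the factors
    on this line are the (j + n)/j for floor(k/2) < j <= k; their product is
    [strip k n]. Hence the product [box k n] of the strips below k is a common
    form of the two products in the theorem ([box_min_exponents],
    [box_rectangle]).

    Dividing the recurrence for [box] by its first term on the right leaves two
    evaluations with N = n + 1:

      box k (N+1) box (k+2) (N-1) / (box k N box (k+2) N) = N / (N + k + 1),
      1 - strip k N / strip (k+1) N = (-1)^k N / (N + k + 1).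

    The first telescopes, since the factors of strip k (n+1) / strip k n cancel
    except at the ends; the second compares two strips that differ in at most
    two factors. *)

(** * Determinants with an invertible block *)

(** Block elimination: the Schur complement of M appears after clearing B. *)
Lemma det_block_schur (F : fieldType) (m p : nat) (A : 'M[F]_m)
    (B : 'M[F]_(m, p)) (C : 'M[F]_(p, m)) (M : 'M[F]_p) :
  M \in unitmx ->
  \det (block_mx A B C M) = \det (A - B *m invmx M *m C) * \det M.
Proof.
move=> uM.
have -> : block_mx A B C M =
    block_mx 1%:M (B *m invmx M) 0 1%:M *m
    block_mx (A - B *m invmx M *m C) 0 C M.
  rewrite mulmx_block !mul1mx !mul0mx !add0r subrK.
  by rewrite -mulmxA mulVmx // mulmx1.
by rewrite det_mulmx det_ublock det_lblock !det1 !mul1r.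
Qed.

Lemma det_mx22 (R : comNzRingType) (A : 'M[R]_2) :
  \det A = A 0 0 * A 1 1 - A 0 1 * A 1 0.
Proof.
rewrite (expand_det_row A 0) !big_ord_recl big_ord0 /cofactor !det_mx11 !mxE /=.
have -> : lift 0 0 = 1 :> 'I_2 by apply/val_inj.
have -> : lift (1 : 'I_2) 0 = 0 :> 'I_2 by apply/val_inj.
by rewrite /= addr0 expr0 expr1 mul1r mulN1r mulrN.
Qed.

(** Every determinant bordering M by one row and one column is an entry of the
    2 x 2 Schur complement times det M, so that this is the formula for the
    2 x 2 determinant of that complement. *)
Lemma det_block_minors (F : fieldType) (p : nat) (A : 'M[F]_2)
    (B : 'M[F]_(2, p)) (C : 'M[F]_(p, 2)) (M : 'M[F]_p)
    (minor := fun i j : 'I_2 =>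
       \det (block_mx (A i j)%:M (row i B) (col j C) M)) :
  M \in unitmx ->
  \det (block_mx A B C M) * \det M
    = minor 0 0 * minor 1 1 - minor 0 1 * minor 1 0.
Proof.
move=> uM; pose S := A - B *m invmx M *m C.
have minorE i j : minor i j = S i j * \det M.
  rewrite /minor det_block_schur // det_mx11 -!row_mul; congr (_ * _).
  rewrite !mxE eqxx mulr1n; congr (_ - _).
  by apply: eq_bigr => k _; rewrite !mxE.
by rewrite !minorE det_block_schur // -/S det_mx22; ring.
Qed.

Lemma det_row_ord_pred (R : comNzRingType) n (a : nat -> 'I_n -> R) :
  \det (\matrix_(i < n, j < n) a (ord_pred i) j)
    = (-1) ^+ perm (@ord_pred_inj n) * \det (\matrix_(i < n, j < n) a i j).
Proof.
rewrite -det_perm -det_mulmx -row_permE; congr (\det _).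
by apply/matrixP=> i j; rewrite !mxE permE.
Qed.

Lemma det_col_ord_pred (R : comNzRingType) n (a : 'I_n -> nat -> R) :
  \det (\matrix_(i < n, j < n) a i (ord_pred j))
    = (-1) ^+ perm (@ord_pred_inj n) * \det (\matrix_(i < n, j < n) a i j).
Proof.
rewrite -odd_permV -det_perm mulrC -det_mulmx -col_permE; congr (\det _).
by apply/matrixP=> i j; rewrite !mxE permE.
Qed.

(** In [det_block_minors] the two bordering lines come first, whereas here they
    are the outer ones. Cyclically shifting both the rows and the columns by
    [ord_pred] moves the last line to the front. The signs of the
    two shifts cancel in the full determinant and in the minor without the first
    lines. The two mixed minors are shifted on one side only, but they occur as a
    product, in which their equal signs cancel. *)
Lemma desnanot_jacobi (F : fieldType) (p : nat) (a : nat -> nat -> F)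
    (minor := fun r c : nat =>
       \det (\matrix_(i < p.+1, j < p.+1) a (r + i)%N (c + j)%N)) :
  \det (\matrix_(i < p, j < p) a i.+1 j.+1) != 0 ->
  \det (\matrix_(i < p.+2, j < p.+2) a i j)
      * \det (\matrix_(i < p, j < p) a i.+1 j.+1)
    = minor 0 0 * minor 1 1 - minor 0 1 * minor 1 0.
Proof.
set M := (\matrix_(i < p, j < p) a i.+1 j.+1) => M0.
have uM : M \in unitmx by rewrite unitmxE unitfE.
pose X : 'M[F]_(2 + p) :=
  \matrix_(i < p.+2, j < p.+2) a (ord_pred i) (ord_pred j).
(* In X the line 0 is the old last one and the line 1 the old first one. *)
have ordl (i : 'I_2) : ord_pred (lshift p i : 'I_p.+2)
    = (if i == 0 then p.+1 else 0%N) :> nat.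
  by case: i => [[|[|]]] //= ?; [rewrite modn_small | rewrite modnn].
have ordr (i : 'I_p) : ord_pred (rshift 2 i : 'I_p.+2) = i.+1 :> nat.
  by rewrite /= add1n modnDr modn_small // !ltnS ltnW.
have ord1l (i : 'I_1) : ord_pred (lshift p i : 'I_p.+1) = p :> nat.
  by rewrite [i]ord1 /= modn_small.
have ord1r (i : 'I_p) : ord_pred (rshift 1 i : 'I_p.+1) = i :> nat.
  by rewrite /= add0n modnDr modn_small // ltnS ltnW.
have MX : M = drsubmx X by apply/matrixP=> i j; rewrite !mxE !ordr.
have detX : \det (\matrix_(i < p.+2, j < p.+2) a i j) = \det X.
  rewrite /X (det_row_ord_pred (fun i j => a i (ord_pred j))).
  by rewrite (det_col_ord_pred (fun i j => a i j)) mulrA -expr2 sqrr_sign mul1r.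
rewrite detX MX -{1}(submxK X) det_block_minors -?MX //.
pose e : F := (-1) ^+ perm (@ord_pred_inj p.+1).
have ee : e * e = 1 by rewrite -expr2 sqrr_sign.
pose Y i j : 'M_(1 + p) := block_mx (ulsubmx X i j)%:M (row i (ursubmx X))
  (col j (dlsubmx X)) M.
rewrite -![block_mx _ _ _ _]/(Y _ _).
have Y11 : \det (Y 1 1) = minor 0%N 0%N.
  congr (\det _); rewrite -[RHS](@submxK _ 1 p 1 p); congr block_mx;
    by apply/matrixP=> i j; rewrite !mxE ?ord1 ?mulr1n ?ordl ?ordr ?ord1.
have Y00 : \det (Y 0 0) = minor 1%N 1%N.
  transitivity (\det (\matrix_(i < p.+1, j < p.+1)
      a (1 + ord_pred i)%N (1 + ord_pred j)%N)).
    congr (\det _); rewrite -[RHS](@submxK _ 1 p 1 p); congr block_mx;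
      by apply/matrixP=> i j;
      rewrite !mxE ?[i]ord1 ?[j]ord1 ?mulr1n ?ordl ?ordr ?ord1l ?ord1r.
  rewrite (det_row_ord_pred (fun i j => a (1 + i)%N (1 + ord_pred j)%N)).
  rewrite (det_col_ord_pred (fun i j => a (1 + i)%N (1 + j)%N)).
  by rewrite mulrA ee mul1r.
have Y01 : \det (Y 0 1) = e * minor 1%N 0%N.
  rewrite -(det_row_ord_pred (fun i j => a (1 + i)%N (0 + j)%N)).
  congr (\det _); rewrite -[RHS](@submxK _ 1 p 1 p); congr block_mx;
    by apply/matrixP=> i j;
      rewrite !mxE ?[i]ord1 ?[j]ord1 ?mulr1n ?ordl ?ordr ?ord1l ?ord1r.
have Y10 : \det (Y 1 0) = e * minor 0%N 1%N.
  rewrite -(det_col_ord_pred (fun i j => a (0 + i)%N (1 + j)%N)).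
  congr (\det _); rewrite -[RHS](@submxK _ 1 p 1 p); congr block_mx;
    by apply/matrixP=> i j;
      rewrite !mxE ?[i]ord1 ?[j]ord1 ?mulr1n ?ordl ?ordr ?ord1l ?ord1r.
rewrite Y00 Y11 Y01 Y10 mulrACA ee mul1r; ring.
Qed.

(** * The product formula as a product of strips *)

Definition strip (k n : nat) : rat :=
  \prod_(k./2.+1 <= j < k.+1) ((j%:R + n%:R) / j%:R).

Definition box (k n : nat) : rat := \prod_(0 <= l < k) strip l n.

Lemma strip_neq0 k n : strip k n != 0.
Proof.
rewrite prodf_seq_neq0; apply/allP=> j; rewrite mem_index_iota => /andP[j0 _].
by rewrite mulf_neq0 ?invr_eq0 // -?natrD pnatr_eq0; lia.
Qed.

Lemma box_neq0 k n : box k n != 0.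
Proof.
by rewrite prodf_seq_neq0; apply/allP=> j _; exact: strip_neq0.
Qed.

Lemma boxS k n : box k.+1 n = box k n * strip k n.
Proof. by rewrite /box big_nat_recr. Qed.

Lemma prod_shift_telescope a b n : (0 < a <= b)%N ->
  \prod_(a <= j < b) ((j%:R + n.+1%:R) / j%:R) * (a + n)%:R
    = \prod_(a <= j < b) ((j%:R + n%:R) / j%:R) * (b + n)%:R :> rat.
Proof.
case/andP=> a0 /subnK <-; elim: (b - a)%N => [|d IHd].
  by rewrite add0n !big_geq.
rewrite addSn !big_nat_recr ?leq_addl //= mulrAC IHd.
have : (d + a)%:R != 0 :> rat by rewrite pnatr_eq0; lia.
rewrite [(_.+1 + n)%N]addSn -!natr1 !natrD => d0.
by field.
Qed.

Lemma strip_stepn k n :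
  strip k n.+1 * (k./2.+1 + n)%:R = strip k n * (k.+1 + n)%:R.
Proof. by apply: prod_shift_telescope; lia. Qed.

(** For k = 2m the strip k + 1 has the one factor j = k + 1 more than the strip
    k; for k = 2m + 1 it gains the factor j = k + 1 and loses j = m + 1. *)
Lemma strip_diff k n :
  (n + k.+1)%:R * (strip k.+1 n - strip k n)
    = (-1) ^+ k * n%:R * strip k.+1 n.
Proof.
rewrite -signr_odd /strip -(odd_double_half k); move: k./2 (odd k) => m [].
  rewrite add1n.
  have -> : (m.*2.+1)./2 = m by lia.
  have -> : (m.*2.+2)./2 = m.+1 by lia.
  rewrite [X in _ - X]big_ltn; last lia.
  rewrite big_nat_recr /=; last lia.
  set Q := \prod_(_ <= _ < _) _; rewrite /= odd_double.
  rewrite !natrD -!muln2 -!natr1 !natrM.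
  by field; rewrite -?natrM !natr1 !pnatr_eq0.
rewrite add0n.
have -> : (m.*2.+1)./2 = m by lia.
have -> : (m.*2)./2 = m by lia.
rewrite big_nat_recr /=; last lia.
set Q := \prod_(_ <= _ < _) _; rewrite /= odd_double.
rewrite !natrD -!muln2 -!natr1 !natrM.
by field; rewrite -?natrM !natr1 !pnatr_eq0.
Qed.

(** The telescoping ratio of [strip_stepn] propagated through k: the factors
    that the strips k and k + 2 contribute to the two sides have the ratio
    (n + k + 2)/(n + k + 3), because their other ends floor(k/2) + n + 2 agree. *)
Lemma box_cross k n :
  (n.+1 + k.+1)%:R * (box k n.+2 * box k.+2 n)
    = n.+1%:R * (box k n.+1 * box k.+2 n.+1).
Proof.
elim: k => [|k IHk].
  have box0 m : box 0 m = 1 by rewrite /box big_geq.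
  have strip0 m : strip 0 m = 1 by rewrite /strip big_geq.
  have strip1 m : strip 1 m = 1 + m%:R by rewrite /strip big_nat1 divr1.
  rewrite !boxS !box0 !strip0 !strip1 !mul1r !natrD -!natr1.
  ring.
rewrite [box k.+1 n.+2]boxS [box k.+3 n]boxS [box k.+1 n.+1]boxS
  [box k.+3 n.+1]boxS.
have e1 := strip_stepn k n.+1; have e2 := strip_stepn k.+2 n.
have c0 : (k./2.+1 + n.+1)%:R != 0 :> rat by rewrite pnatr_eq0.
have c1 : (n.+1 + k.+1)%:R != 0 :> rat by rewrite pnatr_eq0.
have c2 : (k.+2.+1 + n)%:R != 0 :> rat by rewrite pnatr_eq0.
have {}e1 : strip k n.+2 =
    strip k n.+1 * (k.+1 + n.+1)%:R / (k./2.+1 + n.+1)%:R.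
  by rewrite -e1 mulfK.
have {}e2 : strip k.+2 n =
    strip k.+2 n.+1 * (k./2.+2 + n)%:R / (k.+3 + n)%:R.
  by rewrite e2 mulfK.
have {IHk} -> : forall x y, (box k n.+2 * x * (box k.+2 n * y)) =
  n.+1%:R * (box k n.+1 * box k.+2 n.+1) / (n.+1 + k.+1)%:R * (x * y).
  by move=> x y; rewrite -IHk [_%:R * _]mulrC mulfK // mulrACA.
rewrite e1 e2 (_ : (n.+1 + k.+2)%N = (k.+3 + n)%N); last lia.
rewrite (_ : (k./2.+2 + n)%N = (k./2.+1 + n.+1)%N); last lia.
rewrite (_ : (k.+1 + n.+1)%N = (n.+1 + k.+1)%N); last lia.
move: (box _ _) (box _ _) (strip _ _) (strip _ _) => x y z t.
move: c0 c1 c2; move: (_)%:R (_)%:R (_)%:R => u v w; move: (_)%:R => s c0 c1 c2.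
by field; rewrite c0 c1 c2.
Qed.

Lemma box_condensation k n :
  (-1) ^+ k * (box k n.+2 * box k.+2 n)
    = box k n.+1 * box k.+2 n.+1 - box k.+1 n.+1 ^+ 2.
Proof.
have c0 : (n.+1 + k.+1)%:R != 0 :> rat by rewrite pnatr_eq0.
apply: (mulfI c0); rewrite mulrCA box_cross mulrCA mulrA.
have := strip_diff k n.+1; rewrite !boxS => e.
transitivity (box k n.+1 ^+ 2 * strip k n.+1 *
   ((-1) ^+ k * n.+1%:R * strip k.+1 n.+1)).
  by ring.
by rewrite -e; ring.
Qed.

(** * The initial values *)

Lemma box_n0 k : box k 0 = 1.
Proof.
rewrite /box big1_seq // => l _; rewrite /strip big_nat big1 // => j /andP[j0 _].
by rewrite addr0 divff // pnatr_eq0; lia.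
Qed.

Lemma midbin_step k : (midbin k.+1 * k./2.+1 = midbin k * k.+1)%N.
Proof.
rewrite /midbin -(odd_double_half k); move: k./2 (odd k) => m [].
  rewrite add1n.
  have -> : (m.*2.+1)./2 = m by lia.
  have -> : (m.*2.+2)./2 = m.+1 by lia.
  by rewrite mulnC -mul_bin_diag mulnC.
rewrite add0n.
have -> : (m.*2.+1)./2 = m by lia.
have -> : (m.*2)./2 = m by lia.
have := mul_bin_down m.*2.+1 m; rewrite (_ : (_ - _ = m.+1)%N); last lia.
by move=> /= e; rewrite mulnC -e mulnC.
Qed.

Lemma box_n1 k : box k 1 = (midbin k)%:R.
Proof.
elim: k => [|k IHk]; first by rewrite /box big_geq.
have c0 : (k./2.+1)%:R != 0 :> rat by rewrite pnatr_eq0.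
apply: (mulIf c0); rewrite -natrM midbin_step boxS IHk natrM -mulrA.
congr (_ * _); have := strip_stepn k 0; rewrite !addn0 => ->.
rewrite [strip k 0](_ : _ = 1) ?mul1r //.
by have := boxS k 0; rewrite !box_n0 mul1r.
Qed.

(** * Condensation of the Hankel determinants *)

Lemma hankel_det_rat k n :
  (hankel_det k n)%:~R
    = \det (\matrix_(i < n, j < n) (midbin (k + i + j))%:R : 'M[rat]_n).
Proof.
rewrite /hankel_det -det_map_mx; congr (\det _).
by apply/matrixP=> i j; rewrite !mxE.
Qed.

Lemma hankel_condensation k n :
  (hankel_det k.+2 n)%:~R != 0 :> rat ->
  (hankel_det k n.+2)%:~R * (hankel_det k.+2 n)%:~R
    = (hankel_det k n.+1)%:~R * (hankel_det k.+2 n.+1)%:~R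
      - (hankel_det k.+1 n.+1)%:~R ^+ 2 :> rat.
Proof.
have shift r c n' : \det (\matrix_(i < n', j < n')
    (midbin (k + (r + i) + (c + j)))%:R : 'M[rat]_n')
    = (hankel_det (k + (r + c)) n')%:~R.
  rewrite hankel_det_rat; congr (\det _); apply/matrixP=> i j; rewrite !mxE.
  by congr (midbin _)%:R; lia.
have := @desnanot_jacobi _ n (fun i j => (midbin (k + i + j))%:R : rat).
rewrite /= (shift 1 1 n)%N !shift (shift 0 0 n.+2)%N.
by rewrite !addn0 !addn1 !addn2 expr2.
Qed.

(** Two-step induction on n for all k at once. Since C(n+2, 2) + C(n, 2) is
    odd and the signs on the right of the recurrence cancel, the sign
    (-1)^k of [box_condensation] is exactly the one needed. *)
Lemma hankel_det_box n k :
  (hankel_det k n)%:~R = (-1) ^+ (k * 'C(n, 2)) * box k n.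
Proof.
elim/ltn_ind: n k => -[|[|n]] IHn k.
- by rewrite hankel_det_rat det_mx00 muln0 box_n0 mulr1.
- by rewrite hankel_det_rat det_mx11 mxE !addn0 muln0 box_n1 mul1r.
have IH0 := IHn n (leqnSn _); have IH1 := IHn n.+1 (leqnn _).
have h0 : (hankel_det k.+2 n)%:~R != 0 :> rat.
  by rewrite IH0 mulf_neq0 ?signr_eq0 ?box_neq0.
apply: (mulIf h0); rewrite hankel_condensation // !IH1 IH0.
set c := 'C(n, 2); have -> : 'C(n.+1, 2) = (c + n)%N by rewrite binS bin1.
have -> : 'C(n.+2, 2) = (c + n + n.+1)%N by rewrite binS bin1 binS bin1.
rewrite exprMn sqrr_sign mul1r.
transitivity ((-1) ^+ k * (box k n.+2 * box k.+2 n)).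
  rewrite box_condensation mulrACA -exprD.
  rewrite -signr_odd (_ : odd _ = false) ?mul1r //; lia.
rewrite [RHS]mulrACA -exprD -signr_odd -[in RHS]signr_odd; congr (_ ^+ _ * _).
congr nat_of_bool; lia.
Qed.

(** * The two closed forms *)

(** Going from k to k + 1 raises the exponent min(j, k - j) by one exactly when
    floor(k/2) < j <= k, that is for the factors of [strip k n]. *)
Lemma box_min_exponents k n :
  box k n = \prod_(1 <= j < k.+1) ((j%:R + n%:R) / j%:R) ^+ minn j (k - j).
Proof.
elim: k => [|k IHk]; first by rewrite /box !big_geq.
rewrite boxS IHk [RHS]big_nat_recr //= subnn minn0 expr0 mulr1.
rewrite !(@big_cat_nat _ _ _ k./2.+1 1 k.+1) ?ltnS //=; [|lia..].
rewrite -mulrA; congr (_ * _).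
  by apply: eq_big_nat => j Hj; congr (_ ^+ _); lia.
rewrite -big_split /=; apply: eq_big_nat => j Hj.
by rewrite -exprSr; congr (_ ^+ _); lia.
Qed.

(** The new strip, shifted by floor(k/2), is the last row of the rectangle when k
    is odd and its last column when k is even. *)
Lemma box_rectangle k n :
  box k n = \prod_(1 <= i < (k./2).+1) \prod_(1 <= j < (uphalf k).+1)
        ((i%:R + j%:R + n%:R - 1) / (i%:R + j%:R - 1)).
Proof.
elim: k => [|k IHk]; first by rewrite /box !big_geq.
have shifted : strip k n = \prod_(1 <= j < (uphalf k).+1)
    ((j%:R + (k./2)%:R + n%:R) / (j%:R + (k./2)%:R)).
  rewrite /strip -[k./2.+1]add1n big_addn.
  have -> : (k.+1 - k./2 = (uphalf k).+1)%N by lia.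
  by apply: eq_bigr => j _; rewrite natrD.
rewrite boxS IHk shifted; case: (boolP (odd k)) => Ek.
  have -> : uphalf k = k./2.+1 by lia.
  have -> : k.+1./2 = k./2.+1 by lia.
  have -> : uphalf k.+1 = k./2.+1 by lia.
  rewrite [RHS]big_nat_recr //=; congr (_ * _); apply: eq_bigr => j _.
  by congr (_ / _); rewrite -natr1; ring.
have -> : uphalf k = k./2 by lia.
have -> : k.+1./2 = k./2 by lia.
have -> : uphalf k.+1 = k./2.+1 by lia.
rewrite -big_split /=; apply: eq_bigr => i _.
rewrite [RHS]big_nat_recr //=; congr (_ * _).
by congr (_ / _); rewrite -natr1; ring.
Qed.

Theorem theorem1 (k n : nat) :
  (-1) ^+ (k * 'C(n, 2))%N * (hankel_det k n)%:~R
    = \prod_(1 <= j < k.+1) ((j%:R + n%:R) / j%:R : rat) ^+ minn j (k - j)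
  /\
  \prod_(1 <= j < k.+1) ((j%:R + n%:R) / j%:R : rat) ^+ minn j (k - j)
    = \prod_(1 <= i < (k./2).+1) \prod_(1 <= j < (uphalf k).+1)
        ((i%:R + j%:R + n%:R - 1) / (i%:R + j%:R - 1) : rat).
Proof.
split; last by rewrite -box_min_exponents box_rectangle.
by rewrite hankel_det_box mulrA -expr2 sqrr_sign mul1r box_min_exponents.
Qed.
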